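(* Let $(\mathcal{X},\mathcal{F},\sigma)$ be a probability space with an $\alpha$-homogeneous atomic filtration, $0<\alpha\le1/2$, and let $f\in L^1(\mathcal{X})$ satisfy $\|S(f)\|_\infty<\infty$. Then for every $\lambda\ge0$ \[ \bigl|\{x\in\mathcal{X}: f(x)-\mathbb{E}f>\lambda\}\bigr|\le e^{-\alpha\lambda^2/\|Sf\|_\infty^2}. \]
   Context: An atomic filtration on a probability space $(\mathcal{X},\mathcal{F},\sigma)$ is an increasing sequence of $\sigma$-algebras $\mathcal{F}_n\subset\mathcal{F}$, $n\ge0$, with $\mathcal{F}_0=\{\varnothing,\mathcal{X}\}$, $\mathcal{F}$ generated by the $\mathcal{F}_n$, and such that for each $n$ there is a countable collection $\mathcal{D}_n$ of disjoint sets (''cubes'') with every set of $\mathcal{F}_n$ a union of sets of $\mathcal{D}_n$. Write $\mathcal{D}=\bigcup_n\mathcal{D}_n$, $|A|=\sigma(A)$, and for $Q\in\mathcal{D}_n$ let $\operatorname{ch}Q=\{R\in\mathcal{D}_{n+1}:R\subset Q\}$. The filtration is $\alpha$-homogeneous if $|Q'|\ge\alpha|Q|$ for every cube $Q$ and every $Q'\in\operatorname{ch}Q$. For $|A|>0$, $\langle f\rangle_A=|A|^{-1}\int_A f$; $\mathbb{E}f=\langle f\rangle_{\mathcal{X}}$. Let $\mathbf{E}_Q f=\langle f\rangle_Q\mathbf{1}_Q$, $\Delta_Q=\sum_{R\in\operatorname{ch}Q}\mathbf{E}_R-\mathbf{E}_Q$, and $S f=\bigl(\sum_{Q\in\mathcal{D}}|\Delta_Q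 f|^2\bigr)^{1/2}$. *)

(* Defs.v *)
From HB Require Import structures.
From mathcomp Require Import all_boot all_order all_algebra.
From mathcomp Require Import all_classical all_reals all_analysis.
From mathcomp Require Import ess_sup_inf.
Set Implicit Arguments.
Unset Strict Implicit.
Unset Printing Implicit Defensive.
Import Order.TTheory GRing.Theory Num.Theory.
Import numFieldNormedType.Exports.
Local Open Scope classical_set_scope.
Local Open Scope ring_scope.

Definition avg d (T : measurableType d) (R : realType)
  (mu : {measure set T -> \bar R}) (f : T -> R) (A : set T) : R :=
  fine (\int[mu]_(x in A) (f x)%:E) / fine (mu A).

Definition condE d (T : measurableType d) (R : realType)
  (mu : {measure set T -> \bar R}) (f : T -> R) (Q : set T) : T -> R :=
  fun x => avg mu f Q * \1_Q x.

Definition children (T : Type) (D : nat -> set (set T)) (n : nat) (Q : set T)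
  : set (set T) := [set R | D n.+1 R /\ R `<=` Q].

(* Delta_Q f = sum_{R in ch Q} E_R f - E_Q f  (Q in D_n); at each point at most
   one term of the sum is nonzero, so the finitely-supported sum is used *)
Definition Delta d (T : measurableType d) (R : realType)
  (mu : {measure set T -> \bar R}) (D : nat -> set (set T)) (n : nat)
  (Q : set T) (f : T -> R) : T -> R :=
  fun x => (\sum_(S \in children D n Q) condE mu f S x) - condE mu f Q x.

Definition sqfun d (T : measurableType d) (R : realType)
  (mu : {measure set T -> \bar R}) (D : nat -> set (set T)) (f : T -> R)
  : T -> \bar R :=
  fun x => sqrte (\sum_(0 <= n <oo) \esum_(Q in D n) ((Delta mu D n Q f x) ^+ 2)%:E)%E.

Definition atomic_filtration d (T : measurableType d)
  (F D : nat -> set (set T)) : Prop :=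
  (forall n, sigma_algebra setT (F n)) /\
  (forall n, F n `<=` measurable) /\
  (forall n, F n `<=` F n.+1) /\
  F 0%N = [set set0; setT] /\
  (measurable = <<s \bigcup_n F n >>) /\
  (forall n, countable (D n)) /\
  (forall n A B, D n A -> D n B -> A <> B -> A `&` B = set0) /\
  (forall n, D n `<=` F n) /\
  (forall n A, F n A -> exists C, C `<=` D n /\ A = \bigcup_(Q in C) Q).

Definition homogeneous d (T : measurableType d) (R : realType)
  (mu : {measure set T -> \bar R}) (D : nat -> set (set T)) (alpha : R) : Prop :=
  forall n Q S, D n Q -> children D n Q S -> (alpha%:E * mu Q <= mu S)%E.

(* Main.v *)
Require Import Defs.
From HB Require Import structures.
From mathcomp Require Import all_boot all_order all_algebra.
From mathcomp Require Import finmap.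
From mathcomp Require Import all_classical all_reals all_analysis.
From mathcomp Require Import ess_sup_inf measurable_realfun.
From mathcomp Require Import ring lra.
Set Implicit Arguments.
Unset Strict Implicit.
Unset Printing Implicit Defensive.
Import Order.TTheory GRing.Theory Num.Theory.
Import numFieldNormedType.Exports.
Local Open Scope classical_set_scope.
Local Open Scope ring_scope.

(** The heart of the matter is that a centred random variable [X] whose atoms all
    have mass at least [a] satisfies [E (exp (X - X^2 / (4 a))) <= 1]: concavity on
    the positive side reduces this to two atoms, of masses [a] and [1 - a].
    Applied to the increments of [f] from a cube to its children, it makes
    [exp (t (E_n f - E f) - t^2 S_n^2 / (4 a))] a supermartingale, so that
    [E (exp (t (E_n f - E f))) <= exp (t^2 M^2 / (4 a))] with [M = ||S f||_oo];
    the exponent is optimal at [t = 2 a lam / M^2].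

    No martingale convergence is needed to pass from [E_n f] to [f]. With
    [phi = 1 + t (f - E f - lam)] the inequality [1 + y <= exp y], applied on the
    cubes of generation [n], gives [int_B phi <= exp (t^2 M^2 / (4 a) - t lam)] for
    every [B] in the algebra of all [F_n]. Approximation in measure extends this
    bound to all measurable sets, and [phi >= 1] on the set to be estimated. *)

(** * Exponential moments of centred variables with large atoms *)

Section Real.
Variable R : realType.
Implicit Types (f df : R -> R) (p q : {poly R}) (a b x y t u w : R).

Lemma derive_ge0_le f df a b : a <= b ->
  (forall x, is_derive x 1 f (df x)) ->
  (forall x, a <= x <= b -> 0 <= df x) -> f a <= f b.
Proof.
move=> ab fdf df0.
have cf : {within `[a, b], continuous f}.
  apply: continuous_subspaceT => x.
  by apply/differentiable_continuous/derivable1_diffP; case: (fdf x).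
have [c] := MVT_segment ab (fun x _ => fdf x) cf.
rewrite in_itv/= => /df0 dfc fE.
by rewrite -subr_ge0 fE mulr_ge0// subr_ge0.
Qed.

(** Every monotonicity argument below concerns such a product or a sum of two of them. *)
Lemma is_derive_horner_expR p q x :
  is_derive x 1 (fun x => p.[x] * expR q.[x])
    ((p^`().[x] + p.[x] * q^`().[x]) * expR q.[x]).
Proof.
have dq : is_derive x 1 (expR \o horner q) (q^`().[x] * expR q.[x]).
  by apply: is_derive_eq; rewrite mulrC.
apply: (is_derive_eq (is_deriveM (is_derive_poly p x) dq)).
by rewrite /GRing.scale/=; ring.
Qed.

(* [expR x] times the left-hand side has derivative [- (x ^+ 3 / 6) * expR x]. *)
Lemma expRN_ge_taylor3 x : 0 <= x ->
  1 - x + x ^+ 2 / 2 - x ^+ 3 / 6 <= expR (- x).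
Proof.
move=> x0.
pose p : {poly R} := 6^-1 *: 'X^3 - 2^-1 *: 'X^2 + 'X - 1.
have := derive_ge0_le x0 (is_derive_horner_expR p 'X).
have dpE z : p^`().[z] = z ^+ 2 / 2 - z + 1.
  by rewrite /p !poly.derivE !hornerE/=; lra.
have pE z : p.[z] = z ^+ 3 / 6 - z ^+ 2 / 2 + z - 1.
  by rewrite /p !hornerE/=; ring.
rewrite !pE !hornerE/= expR0 => H.
have {}H : - 1 <= (x ^+ 3 / 6 - x ^+ 2 / 2 + x - 1) * expR x.
  apply: (le_trans _ (H _)); first lra.
  move=> z /andP[z0 _]; rewrite dpE pE derivX !hornerE/=.
  by rewrite mulr_ge0// ?expR_ge0//; nra.
rewrite expRN -[leRHS]div1r ler_pdivlMr ?expR_gt0//; lra.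
Qed.

(* Divided by [a], the polynomial decreases in [a]; its value at [a = 1 / 2] is [Z]. *)
Lemma two_point_poly a t : 0 < a <= 1 / 2 -> 0 <= t <= 1 ->
  0 <= t ^+ 2 - a * t * (1 + t) + a * (1 - t ^+ 2) ^+ 2 / 2 +
    a ^+ 2 * (t * (1 + t) * (1 - t ^+ 2) / 2 - (1 - t ^+ 2) ^+ 3 / 6) -
    a ^+ 3 * t * (1 + t) * (1 - t ^+ 2) ^+ 2 / 6.
Proof.
move=> /andP[a0 a1] /andP[t0 t1].
set Y := t * (1 + t) * (1 - t ^+ 2) ^+ 2 / 6.
set X := t * (1 + t) * (1 - t ^+ 2) / 2 - (1 - t ^+ 2) ^+ 3 / 6.
set Z := (1 - t) ^+ 2 * (10 + t + 3 * t ^+ 2 + t ^+ 3 + t ^+ 4) / 24.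
rewrite [leRHS](_ : _ =
    a * Z + (1 / 2 - a) * (2 * t ^+ 2 - a * X + a * (a + 1 / 2) * Y)); last first.
  by rewrite /X /Y /Z; field.
have w0 : 0 <= 1 - t ^+ 2 by nra.
have Z0 : 0 <= Z.
  by rewrite /Z divr_ge0// mulr_ge0 ?sqr_ge0// !addr_ge0 ?mulr_ge0 ?exprn_ge0.
have Y0 : 0 <= Y by rewrite /Y divr_ge0// !mulr_ge0 ?sqr_ge0//; lra.
have X4 : X <= 4 * t ^+ 2.
  (* On [[0, 1]] the maximum of [(1 + t) * (1 - t ^+ 2)] is [32 / 27], attained at [t = 1 / 3]. *)
  have h1 : t * (1 + t) * (1 - t ^+ 2) / 2 <= 6 / 10 * t.
    have : (1 + t) * (1 - t ^+ 2) <= 12 / 10.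
      have := mulr_ge0 t0 (sqr_ge0 (t - 1 / 3)); have := sqr_ge0 (t - 1 / 3); lra.
    nra.
  (* Beyond [1 / 5], [6 / 10 * t <= 4 * t ^+ 2] already holds; below it, the subtracted cube makes
     up the difference. *)
  rewrite /X; have [t5|t5] := leP t (1 / 5).
    have h2 : (24 / 25) ^+ 3 <= (1 - t ^+ 2) ^+ 3.
      by rewrite lerXn2r ?nnegrE//; nra.
    nra.
  have h2 : 0 <= (1 - t ^+ 2) ^+ 3 by rewrite exprn_ge0.
  nra.
apply: addr_ge0; apply: mulr_ge0 => //; [lra|lra|].
have : a * X <= 2 * t ^+ 2.
  have [X0|X0] := leP X 0; nra.
have : 0 <= a * (a + 1 / 2) * Y by rewrite !mulr_ge0//; lra.
lra.
Qed.

(* With [t = 1 - u] and [w = 2 u - u ^+ 2 = 1 - t ^+ 2], the cubic Taylor bound for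
   [expR (- (a * w))] reduces this to [two_point_poly]. *)
Lemma two_point_derive_ge0 a u : 0 < a <= 1 / 2 -> 0 <= u <= 1 ->
  a ^+ 2 * (1 - u) <=
  (a + (1 - a) * u) * (expR (- (a * (2 * u - u ^+ 2))) - (1 - a)).
Proof.
move=> a01 /andP[u0 u1]; have /andP[a0 a1] := a01.
have t01 : 0 <= 1 - u <= 1 by lra.
have := two_point_poly a01 t01.
have w0 : 0 <= a * (2 * u - u ^+ 2) by rewrite mulr_ge0//; nra.
have := expRN_ge_taylor3 w0.
set e := expR _; set x := a * _ => taylor poly.
have c0 : 0 <= a + (1 - a) * u by nra.
have := ler_wpM2l c0 taylor.
have : 0 <= a * u * ((1 - u) ^+ 2 - a * (1 - u) * (1 + (1 - u)) +
    a * (1 - (1 - u) ^+ 2) ^+ 2 / 2 +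
    a ^+ 2 * ((1 - u) * (1 + (1 - u)) * (1 - (1 - u) ^+ 2) / 2 -
      (1 - (1 - u) ^+ 2) ^+ 3 / 6) -
    a ^+ 3 * (1 - u) * (1 + (1 - u)) * (1 - (1 - u) ^+ 2) ^+ 2 / 6).
  by rewrite mulr_ge0// mulr_ge0// ltW.
rewrite [X in 0 <= X](_ : _ = (a + (1 - a) * u) *
   (1 - x + x ^+ 2 / 2 - x ^+ 3 / 6 - (1 - a)) - a ^+ 2 * (1 - u)); last first.
  by rewrite /x; field.
lra.
Qed.

(** This is the two-atom case: masses [1 - a] and [a] sit at [2 * a * u] and [- (2 * (1 - a) * u)].
    Multiplying by [expR q], the inverse of the second exponential, turns the claim into
    [a <= expR q - (1 - a) * expR r]. This is an equality at [u = 0], and the right-hand side is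
    nondecreasing by [two_point_derive_ge0]. *)
Lemma two_point a u : 0 < a <= 1 / 2 -> 0 <= u <= 1 ->
  (1 - a) * expR (a * (2 * u - u ^+ 2)) +
  a * expR (- (2 * (1 - a) * u + (1 - a) ^+ 2 * u ^+ 2 / a)) <= 1.
Proof.
move=> a01 /andP[u0 u1]; have /andP[a0 a1] := a01.
pose q : {poly R} := (2 * (1 - a)) *: 'X + ((1 - a) ^+ 2 / a) *: 'X^2.
pose r : {poly R} := q + a *: (2 *: 'X - 'X^2).
have qE z : q.[z] = 2 * (1 - a) * z + (1 - a) ^+ 2 * z ^+ 2 / a.
  by rewrite /q !hornerE/=; ring.
have rE z : r.[z] = q.[z] + a * (2 * z - z ^+ 2) by rewrite /r !hornerE.
have dqE z : q^`().[z] = 2 * (1 - a) / a * (a + (1 - a) * z).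
  by rewrite /q !poly.derivE !hornerE/=; field; lra.
have drE z : r^`().[z] = q^`().[z] + 2 * a * (1 - z).
  by rewrite /r !poly.derivE !hornerE/=; ring.
have dF (z : R) : is_derive z 1
    (fun z => 1%:P.[z] * expR q.[z] + (- (1 - a))%:P.[z] * expR r.[z])
    (q^`().[z] * expR q.[z] - (1 - a) * (r^`().[z] * expR r.[z])).
  apply: (is_derive_eq (is_deriveD (is_derive_horner_expR 1%:P q z)
             (is_derive_horner_expR (- (1 - a))%:P r z))).
  by rewrite !derivC !hornerE/=; ring.
have := derive_ge0_le u0 dF.
rewrite !hornerC !mul1r !rE !qE !mulr0 expr0n/= !mulr0 mul0r subr0 mulr0 !addr0.
rewrite expR0 mulr1 -qE => H.
have {}H : a <= expR q.[u] - (1 - a) * expR (q.[u] + a * (2 * u - u ^+ 2)).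
  rewrite -mulNr; apply: le_trans (H _); first lra.
  move=> z /andP[z0 zu].
  rewrite drE dqE rE expRD.
  have z01 : 0 <= z <= 1 by lra.
  have := two_point_derive_ge0 a01 z01.
  rewrite expRN.
  set e := expR (a * _); have e0 : 0 < e by exact: expR_gt0.
  have E0 := expR_gt0 q.[z].
  set E := expR q.[z] in E0 *.
  move=> H1.
  have {}H1 : 0 <= (a + (1 - a) * z) * (1 - (1 - a) * e) - a ^+ 2 * (1 - z) * e.
    rewrite (_ : _ - _ = ((a + (1 - a) * z) * (e^-1 - (1 - a)) -
       a ^+ 2 * (1 - z)) * e).
      by apply: mulr_ge0; [rewrite subr_ge0|exact: ltW].
    by field; rewrite gt_eqF.
  rewrite [leRHS](_ : _ = 2 * (1 - a) / a * E *
    ((a + (1 - a) * z) * (1 - (1 - a) * e) - a ^+ 2 * (1 - z) * e)).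
    apply: mulr_ge0 => //; apply: mulr_ge0; last exact: ltW.
    by apply: divr_ge0; lra.
  by field; rewrite gt_eqF.
have := expR_gt0 q.[u] => E0.
rewrite expRN; move: H; rewrite expRD; set e := expR (a * _).
move=> H.
have := ler_wpM2r (ltW (_ : 0 < (expR q.[u])^-1)) H.
rewrite invr_gt0 E0 => /(_ isT).
rewrite mulrBl divff ?gt_eqF// mulrCA mulrAC divff ?gt_eqF// mul1r; lra.
Qed.

(* The quotient of the two sides has derivative of the sign of [u - u0]. *)
Lemma expR_parabola_tangent a u0 u : 0 < a <= 1 / 2 -> 0 <= u0 <= 1 -> 0 <= u ->
  expR (a * (2 * u - u ^+ 2)) <=
  expR (a * (2 * u0 - u0 ^+ 2)) * (1 + 2 * a * (1 - u0) * (u - u0)).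
Proof.
move=> /andP[a0 a1] /andP[u00 u01] uge0.
pose p : {poly R} := (2 * a * (1 - u0)) *: 'X + (1 - 2 * a * (1 - u0) * u0)%:P.
pose q : {poly R} := a *: ('X^2 - 2 *: 'X).
pose p' : {poly R} := - p.
have pE z : p.[z] = 1 + 2 * a * (1 - u0) * (z - u0).
  by rewrite /p !hornerE/=; ring.
have qE z : q.[z] = - (a * (2 * z - z ^+ 2)) by rewrite /q !hornerE/=; ring.
have dpE z : p^`().[z] = 2 * a * (1 - u0).
  by rewrite /p !poly.derivE !hornerE/=; ring.
have dqE z : q^`().[z] = 2 * a * (z - 1).
  by rewrite /q !poly.derivE !hornerE/=; ring.
have key : expR q.[u0] <= p.[u] * expR q.[u].
  have -> : expR q.[u0] = p.[u0] * expR q.[u0].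
    by rewrite pE subrr mulr0 addr0 mul1r.
  have dE z : p^`().[z] + p.[z] * q^`().[z] =
      2 * a * (z - u0) * (1 - 2 * a * (1 - u0) * (1 - z)).
    by rewrite dpE pE dqE; ring.
  have d0 z : 0 <= z -> 0 <= 1 - 2 * a * (1 - u0) * (1 - z).
    move=> z0; have : (1 - u0) * (1 - z) <= 1 by nra.
    nra.
  have [uu0|u0u] := leP u0 u.
    apply: (derive_ge0_le uu0 (is_derive_horner_expR p q)) => z /andP[u0z _].
    rewrite dE !mulr_ge0 ?expR_ge0 ?d0//; lra.
  (* To the left of [u0] the quotient decreases, so its negative is used. *)
  have := derive_ge0_le (ltW u0u) (is_derive_horner_expR p' q).
  rewrite /p' !hornerN !mulNr lerN2; apply => z /andP[uz zu0].
  rewrite derivN !hornerN [- p.[z] * _]mulNr -opprD dE -mulNr -mulrN.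
  by rewrite !mulr_ge0 ?expR_ge0 ?d0//; lra.
move: key; rewrite !qE pE !expRN.
set A := expR _; set B := expR _.
have A0 : 0 < A := expR_gt0 _; have B0 : 0 < B := expR_gt0 _.
by rewrite ler_pdivlMr// mulrC ler_pdivrMr// mulrC.
Qed.

(* [h] lies below a line on the positive half-axis and below another one, through
   [(0, 1)], on [[- (s / a), 0]]; the two-point inequality balances them. *)
Lemma gauss_envelope a s : 0 < a <= 1 / 2 -> 0 < s ->
  let h x := expR (x - x ^+ 2 / (4 * a)) in
  exists A B k : R, [/\ 1 <= A,
    forall x, 0 <= x -> h x <= A + B * x,
    forall y, 0 <= y <= s / a -> h (- y) <= 1 - k * y &
    (1 - a) * A + a + (B - k) * s <= 1].
Proof.
move=> a01 s0 h; have /andP[a0 a1] := a01.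
have b0 : 0 < 1 - a by lra.
pose E u := expR (a * (2 * u - u ^+ 2)).
(* An atom of mass [a] at [- (s / a)] is balanced by one of mass [1 - a] at [z0]. *)
pose z0 := s / (1 - a).
have z00 : 0 < z0 by rewrite divr_gt0.
have hE x : h x = E (x / (2 * a)).
  by rewrite /h /E; congr expR; field; rewrite gt_eqF.
(* [E] peaks at [1], so a tangent point beyond it is moved back to [1], where the tangent is
   horizontal. Either the cap is inactive or [1 - cap z] vanishes; hence the last clause of
   [capP]. *)
pose cap z := Num.min 1 (z / (2 * a)).
have capP z : 0 <= z ->
    [/\ 0 <= cap z <= 1, 2 * a * cap z <= z &
        (1 - cap z) * (2 * a * cap z) = (1 - cap z) * z].
  move=> zge0; rewrite /cap; have [h1|h1] := leP 1 (z / (2 * a)).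
    by rewrite ler01 lexx subrr !mul0r; split => //;
      move: h1; rewrite ler_pdivlMr; lra.
  have eE : 2 * a * (z / (2 * a)) = z by field; rewrite gt_eqF.
  rewrite eE; split => //; apply/andP; split; last exact: ltW.
  by apply: divr_ge0; lra.
pose u0 := cap z0; pose H0 := E u0.
have [u001 u0z zE] := capP _ (ltW z00).
have H00 : 0 < H0 := expR_gt0 _.
have line x : 0 <= x -> h x <= H0 * (1 - (1 - u0) * z0) + H0 * (1 - u0) * x.
  move=> x0; have xa : 0 <= x / (2 * a) by rewrite divr_ge0//; lra.
  rewrite hE (le_trans (expR_parabola_tangent a01 u001 xa))//.
  rewrite -/(E u0) -/H0 [leRHS](_ : _ =
    H0 * (1 - (1 - u0) * z0 + (1 - u0) * x)); last ring.
  rewrite ler_pM2l// -zE -/u0.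
  rewrite le_eqVlt; apply/orP; left; apply/eqP.
  by field; rewrite gt_eqF.
(* [A] and [B] are the intercept and slope found in [line]; this [k] makes the final balance an
   equality. *)
exists (H0 * (1 - (1 - u0) * z0)), (H0 * (1 - u0)), ((H0 - 1) / z0).
split => //.
- by have := line 0 (lexx _); rewrite /h expr0n/= mul0r subr0 expR0 mulr0 addr0.
- move=> y /andP[y0 ys].
  (* [z] balances [- y] as [z0] balances [- (s / a)]. *)
  pose z := a * y / (1 - a); pose v := cap z.
  have zge0 : 0 <= z by rewrite /z divr_ge0 ?mulr_ge0//; exact: ltW.
  have zz0 : z <= z0.
    by rewrite /z /z0 ler_pM2r ?invr_gt0// mulrC -ler_pdivlMr.
  have [v01 vz vE] := capP _ zge0; rewrite -/v in v01 vz vE.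
  have := two_point a01 v01; rewrite -/(E v).
  have Ev0 : 0 < E v := expR_gt0 _.
  (* The cap can only replace [y] by a smaller [Y >= 0], and [h (- y)] decreases in [y >= 0]. *)
  have hy : h (- y) <=
      expR (- (2 * (1 - a) * v + (1 - a) ^+ 2 * v ^+ 2 / a)).
    pose Y := 2 * (1 - a) * v.
    have Yy : Y <= y.
      have : 2 * a * v * (1 - a) <= a * y by rewrite -ler_pdivlMr.
      rewrite /Y; nra.
    have Y0 : 0 <= Y by rewrite /Y; case/andP: v01 => *; rewrite !mulr_ge0//; lra.
    rewrite /h ler_expR [leRHS](_ : _ = - Y - Y ^+ 2 / (4 * a)); last first.
      by rewrite /Y; field; rewrite gt_eqF.
    rewrite sqrrN lerB ?lerN2// ler_pM2r ?invr_gt0; last lra.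
    by rewrite lerXn2r.
  (* The tangent at [v] is at least [1] at [0] and at least [H0] at [z0]. Averaging with weights
     [z0 - z] and [z] gives [c3], which puts [E v] above the chord from [(0, 1)] to [(z0, H0)]. *)
  have c1 : 1 <= E v * (1 - (1 - v) * z).
    have := expR_parabola_tangent a01 v01 (lexx 0).
    rewrite -/(E v) expr0n/= mulr0 subr0 mulr0 expR0 sub0r -vE.
    by rewrite (_ : 2 * a * (1 - v) * - v = - ((1 - v) * (2 * a * v))); last ring.
  have c2 : H0 <= E v * (1 + (1 - v) * (z0 - z)).
    have /andP[u00 _] := u001.
    have := expR_parabola_tangent a01 v01 u00.
    rewrite -/(E v) -/(E u0) -/H0 => /le_trans; apply; rewrite ler_pM2l// lerD2l.
    rewrite (_ : 2 * a * (1 - v) * (u0 - v) =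
      (1 - v) * (2 * a * u0) - (1 - v) * (2 * a * v)); last ring.
    rewrite vE -mulrBr ler_wpM2l//; last by rewrite lerD2r.
    by case/andP: v01; lra.
  have c3 : z0 - z + z * H0 <= z0 * E v.
    have := ler_wpM2l zge0 c2.
    have : 0 <= z0 - z by lra.
    move=> /ler_wpM2l => /(_ _ _ c1); lra.
  have c4 : 1 + (H0 - 1) / z0 * z <= E v.
    rewrite -(ler_pM2l z00) mulrDr mulr1 mulrA [z0 * _]mulrC divfK ?gt_eqF//.
    lra.
  move=> tp; rewrite -(ler_pM2l a0).
  have := ler_wpM2l (ltW b0) c4; have := ler_wpM2l (ltW a0) hy.
  have -> : (1 - a) * (1 + (H0 - 1) / z0 * z) =
      1 - a + a * ((H0 - 1) / z0 * y).
    by rewrite /z; field; rewrite !gt_eqF.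
  lra.
- have -> : s = (1 - a) * z0 by rewrite /z0 mulrC divfK ?gt_eqF.
  rewrite le_eqVlt; apply/orP; left; apply/eqP.
  by field; rewrite gt_eqF.
Qed.

(** The negative atoms have total mass [m >= a] and first moment [- r]. Each has mass at least [a],
    so it lies above [- (r / a)], and [gauss_envelope] with [s = r] bounds every term by a line.
    Centring determines the sum of the lines, and since [A >= 1], replacing [m] by [a] only raises
    it. *)
Lemma sum_gauss_le1 (I : eqType) (s : seq I) (p x : I -> R) a :
  0 < a <= 1 / 2 -> {in s, forall i, a <= p i} ->
  \sum_(i <- s) p i = 1 -> \sum_(i <- s) p i * x i = 0 ->
  \sum_(i <- s) p i * expR (x i - x i ^+ 2 / (4 * a)) <= 1.
Proof.
move=> a01 pa p1 px0; have /andP[a0 a1] := a01.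
have p0 i : i \in s -> 0 <= p i by move=> /pa; lra.
(* Without negative values, the tangent at [0] bounds each exponential by [1 + x i], and centring
   concludes. *)
have [/hasP[j js xj]|/hasPn xge0] := boolP (has (fun i => x i < 0) s); last first.
  rewrite [leRHS](_ : _ = \sum_(i <- s) (p i + p i * x i)); last first.
    by rewrite big_split/= p1 px0 addr0.
  rewrite big_seq [leRHS]big_seq.
  apply: ler_sum => i si; rewrite -{2}[p i]mulr1 -mulrDr ler_wpM2l ?p0//.
  have := xge0 _ si; rewrite -leNgt => xi.
  have xa : 0 <= x i / (2 * a) by rewrite divr_ge0//; lra.
  have h01 : 0 <= (0 : R) <= 1 by rewrite lexx ler01.
  have := expR_parabola_tangent a01 h01 xa.
  rewrite expr0n/= mulr0 !subr0 mulr0 expR0 mul1r mulr1.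
  rewrite (_ : 2 * a * (x i / (2 * a)) = x i); last by field; rewrite gt_eqF.
  by apply: le_trans; rewrite ler_expR le_eqVlt; apply/orP; left; apply/eqP;
    field; rewrite gt_eqF.
pose n i : R := (x i < 0)%R%:R.
pose m := \sum_(i <- s) p i * n i.
pose r := - \sum_(i <- s) p i * n i * x i.
have rterm i : i \in s -> 0 <= p i * n i * - x i.
  move=> si; rewrite /n; have [xi|xi] := ltP (x i) 0; last by rewrite mulr0 mul0r.
  by rewrite !mulr_ge0 ?p0// oppr_ge0 ltW.
have rE : r = \sum_(i <- s) p i * n i * - x i.
  by rewrite /r -sumrN; apply: eq_bigr => i _; rewrite mulrN.
have le_r i : i \in s -> p i * n i * - x i <= r.
  move=> si; rewrite rE (big_rem i si)/= lerDl big_seq sumr_ge0// => k /mem_rem.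
  exact: rterm.
have am : a <= m.
  rewrite /m (big_rem j js)/= /n xj mulr1 (le_trans (pa _ js))// lerDl.
  rewrite big_seq sumr_ge0// => k /mem_rem sk.
  by rewrite mulr_ge0 ?p0.
have r0 : 0 < r.
  rewrite (lt_le_trans _ (le_r _ js))// /n xj mulr1 mulr_gt0 ?oppr_gt0//.
  by have := pa _ js; lra.
have [A [B [k [A1 pos neg bal]]]] := gauss_envelope a01 r0.
have : \sum_(i <- s) p i * expR (x i - x i ^+ 2 / (4 * a)) <=
  \sum_(i <- s) (A * p i - (A - 1) * (p i * n i) + B * (p i * x i) -
                 (B - k) * (p i * n i * x i)).
  rewrite big_seq [leRHS]big_seq; apply: ler_sum => i si.
  rewrite [leRHS](_ : _ = p i *
    (A - (A - 1) * n i + B * x i - (B - k) * (n i * x i))); last ring.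
  rewrite ler_wpM2l ?p0// /n; have [xi|xi] /= := ltP (x i) 0.
    have xr : 0 <= - x i <= r / a.
      rewrite oppr_ge0 ltW//= ler_pdivlMr// mulrC (le_trans _ (le_r _ si))//.
      by rewrite /n xi mulr1 ler_wpM2r ?pa// oppr_ge0 ltW.
    have := neg _ xr; rewrite opprK => /le_trans; apply; lra.
  by have := pos _ xi => /le_trans; apply; lra.
rewrite !big_split/= !sumrN -!mulr_sumr -/m p1 px0 mulr1 mulr0 addr0.
have -> : \sum_(i <- s) p i * n i * x i = - r by rewrite opprK.
move=> /le_trans; apply.
have : (A - 1) * a <= (A - 1) * m by rewrite ler_wpM2l//; lra.
lra.
Qed.

End Real.

(** * Approximation by a generating algebra *)

Section Approximation.
Context (d : measure_display) (T : measurableType d) (R : realType).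
Variables (mu : {finite_measure set T -> \bar R}) (G : set (set T)).
Hypotheses (G0 : G set0) (GC : setC_closed G) (GU : setU_closed G).
Hypothesis (Gm : G `<=` measurable).

(** The approximable sets form a sigma-algebra containing [G]. For a countable union, the partial
    unions are approximable, and by continuity from below one of them misses mass less than
    [e / 2]. *)
Lemma approx_by_algebra (A : set T) : <<s G >> A ->
  measurable A /\
  forall e : R, 0 < e -> exists2 B, G B & (mu (A `+` B) < e%:E)%E.
Proof.
pose C := [set A : set T | measurable A /\
  forall e : R, 0 < e -> exists2 B, G B & (mu (A `+` B) < e%:E)%E].
have mY (A1 B1 : set T) : measurable A1 -> measurable B1 -> measurable (A1 `+` B1).
  by move=> ? ?; apply: measurableU; exact: measurableD.
have C0 : C set0.
  split => // e e0; exists set0 => //.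
  by rewrite setYK measure0 lte_fin.
have CU (A1 A2 : set T) : C A1 -> C A2 -> C (A1 `|` A2).
  move=> [mA1 a1] [mA2 a2]; split; first exact: measurableU.
  move=> e e0; have e20 : 0 < e / 2 by rewrite divr_gt0.
  have [B1 GB1 AB1] := a1 _ e20; have [B2 GB2 AB2] := a2 _ e20.
  exists (B1 `|` B2); first exact: GU.
  have mB1 := Gm GB1; have mB2 := Gm GB2.
  have sub : (A1 `|` A2) `+` (B1 `|` B2) `<=` (A1 `+` B1) `|` (A2 `+` B2).
    move=> x [[[A1x|A2x] /not_orP[nB1 nB2]]|[[B1x|B2x] /not_orP[nA1 nA2]]].
    - by left; left.
    - by right; left.
    - by left; right.
    - by right; right.
  apply: (@le_lt_trans _ _ (mu ((A1 `+` B1) `|` (A2 `+` B2)))).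
    by apply: le_measure; rewrite ?inE//;
      [apply: (mY) => //; exact: measurableU|apply: measurableU; exact: mY].
  apply: le_lt_trans (measureU2 _ _ _) _; [exact: mY|exact: mY|].
  by rewrite [e]splitr EFinD; apply: lteD.
suff : <<s G >> `<=` C by apply.
apply: smallest_sub; last first.
  move=> {}A GA; split; first exact: Gm.
  by move=> e e0; exists A => //; rewrite setYK measure0 lte_fin.
split => // [{}A [mA a]|{}A CA].
  rewrite setTD; split; first exact: measurableC.
  move=> e /a[B GB AB]; exists (~` B); first exact: GC.
  suff -> : ~` A `+` ~` B = A `+` B by [].
  by rewrite /setY !setDE !setCK setUC [~` B `&` _]setIC [~` A `&` _]setIC.
have mA n : measurable (A n) by have [] := CA n.
have mUA : measurable (\bigcup_n A n) by exact: bigcup_measurable.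
split => // e e0; have e20 : 0 < e / 2 by rewrite divr_gt0.
pose S n := \big[setU/set0]_(i < n.+1) A i.
have CS n : C (S n).
  rewrite /S; elim: n.+1 => {n} [|n ih]; first by rewrite big_ord0.
  by rewrite big_ord_recr; exact: CU.
have mS n : measurable (S n) by have [] := CS n.
have US : \bigcup_n S n = \bigcup_n A n.
  by rewrite /S; exact: bigcup_bigsetU_bigcup.
have ndS : nondecreasing_seq S.
  by move=> m n mn; apply/subsetPset; exact: subset_bigsetU.
have cS : mu \o S @ \oo --> mu (\bigcup_n A n).
  by rewrite -US; apply: nondecreasing_cvg_mu => //; rewrite US.
have [n small] : exists n, (mu ((\bigcup_n A n) `\` S n) < (e / 2)%:E)%E.
  have fU : mu (\bigcup_n A n) \is a fin_num by exact: fin_num_measure.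
  have lt : (mu (\bigcup_n A n) - (e / 2)%:E < mu (\bigcup_n A n))%E.
    by rewrite lteBlDr// lteDl// lte_fin.
  have [N _ /(_ N (leqnn _)) /= hN] := cS _ (open_ereal_gt' lt).
  exists N; rewrite measureD//; last by rewrite -ge0_fin_numE.
  rewrite setIidr; last by rewrite -US; exact: bigcup_sup.
  by rewrite lteBlDr ?fin_num_measure// addeC -lteBlDr.
have [B GB AB] := (CS n).2 _ e20; exists B => //.
have mB := Gm GB.
have sub : (\bigcup_n A n) `+` B `<=` ((\bigcup_n A n) `\` S n) `|` (S n `+` B).
  move=> x [[Ax nB]|[Bx nA]].
    by have [Sx|nSx] := pselect (S n x); [right; left|left].
  by right; right; split => // Sx; apply: nA; rewrite -US; exists n.
apply: (@le_lt_trans _ _ (mu (((\bigcup_n A n) `\` S n) `|` (S n `+` B)))).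
  by apply: le_measure; rewrite ?inE//;
    [exact: mY|apply: measurableU; [exact: measurableD|exact: mY]].
apply: le_lt_trans (measureU2 _ _ _) _; [exact: measurableD|exact: mY|].
by rewrite [e]splitr EFinD; apply: lteD.
Qed.

(** By absolute continuity of the integral, replacing [A] by a close [B] in [G] costs at most
    [e / 2] on each of the two differences. *)
Lemma Rintegral_le_generated (phi : T -> R) (K : R) :
  mu.-integrable setT (EFin \o phi) ->
  (forall B, G B -> \int[mu]_(x in B) phi x <= K) ->
  forall A, <<s G >> A -> \int[mu]_(x in A) phi x <= K.
Proof.
move=> iphi GK A /approx_by_algebra[mA approx].
apply/ler_addgt0Pr => e e0; have e20 : 0 < e / 2 by rewrite divr_gt0.
have [r [r0 small]] := integral_normr_continuous iphi e20.
have [B GB AB] := approx _ r0; have mB := Gm GB.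
have iS (E : set T) : measurable E -> mu.-integrable E (EFin \o phi).
  by move=> mE; apply: integrableS iphi.
have split_int (E E' : set T) : measurable E -> measurable E' ->
    \int[mu]_(x in E) phi x =
    \int[mu]_(x in E `&` E') phi x + \int[mu]_(x in E `\` E') phi x.
  move=> mE mE'; have mI := measurableI _ _ mE mE'; have mD := measurableD mE mE'.
  rewrite -Rintegral_setU//; first by rewrite setUIDK.
    by rewrite setUIDK; exact: iS.
  by apply/disj_setPS => x [[_ ?] [_ ?]].
have smallD (E : set T) : measurable E -> E `<=` A `+` B ->
    `|\int[mu]_(x in E) phi x| <= e / 2.
  move=> mE EY; rewrite (le_trans (le_normr_Rintegral mE (iS _ mE)))// ltW// small//.
  apply: le_lt_trans AB; apply: le_measure => //; rewrite inE//.
  by apply: measurableU; exact: measurableD.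
have := GK _ GB; rewrite (split_int A B)// (split_int B A)// setIC.
have := smallD (A `\` B) (measurableD mA mB) (@subsetUl _ _ _).
have := smallD (B `\` A) (measurableD mB mA) (@subsetUr _ _ _).
rewrite !ler_norml => /andP[? ?] /andP[? ?]; lra.
Qed.

End Approximation.

(** * Atomic filtrations *)

Lemma Rintegral_bigsetU (d : measure_display) (T : measurableType d) (R : realType)
    (mu : {measure set T -> \bar R}) (I : eqType) (s : seq I) (E : I -> set T)
    (phi : T -> R) :
  mu.-integrable setT (EFin \o phi) -> uniq s ->
  {in s, forall i, measurable (E i)} -> trivIset [set` s] E ->
  \int[mu]_(x in \big[setU/set0]_(i <- s) E i) phi x =
  \sum_(i <- s) \int[mu]_(x in E i) phi x.
Proof.
move=> iphi us mE tE.
(* Emptying [E] off [s] makes the family measurable at every index. *)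
pose E' i := if i \in s then E i else set0.
have E'E : {in s, E' =1 E} by move=> i si; rewrite /E' si.
have mE' i : measurable (E' i) by rewrite /E'; case: ifPn => // /mE.
have tE' : trivIset [set` s] E'.
  by move=> i j /= si sj; rewrite /E' si sj; exact: tE.
have -> : \big[setU/set0]_(i <- s) E i = \big[setU/set0]_(i <- s) E' i.
  by rewrite big_seq [RHS]big_seq; apply: eq_bigr => i si; rewrite E'E.
rewrite /Rintegral integral_bigsetU_EFin//; last first.
  apply: (@measurable_funS _ _ _ _ setT) => //.
  by case/integrableP: iphi.
rewrite (eq_bigr (fun i => (\int[mu]_(x in E' i) phi x)%:E)) => [|i _].
  rewrite sumEFin/= big_seq [RHS]big_seq.
  by apply: eq_bigr => i si; rewrite /Rintegral E'E.
rewrite fineK//; apply: integrable_fin_num => //; exact: integrableS iphi.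
Qed.

Section Cubes.
Context (d : measure_display) (T : measurableType d) (R : realType).
Variables (P : probability T R) (F D : nat -> set (set T)) (alpha : R).
Hypothesis atF : atomic_filtration F D.

Let sF n : sigma_algebra setT (F n) := atF.1 n.
Let mF n : F n `<=` measurable := atF.2.1 n.
Let FS n : F n `<=` F n.+1 := atF.2.2.1 n.
Let F0E : F 0%N = [set set0; setT] := atF.2.2.2.1.
Let genF : measurable = <<s \bigcup_n F n >> := atF.2.2.2.2.1.
Let disjD n A B : D n A -> D n B -> A <> B -> A `&` B = set0 :=
  @atF.2.2.2.2.2.2.1 n A B.
Let DF n : D n `<=` F n := atF.2.2.2.2.2.2.2.1 n.
Let atomD n A : F n A -> exists C, C `<=` D n /\ A = \bigcup_(Q in C) Q :=
  @atF.2.2.2.2.2.2.2.2 n A.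

(** * Nesting of cubes and the cube through a point *)

Lemma cube_measurable n Q : D n Q -> measurable Q.
Proof. by move=> /DF/mF. Qed.

Lemma cube_eq n Q Q' x : D n Q -> D n Q' -> Q x -> Q' x -> Q = Q'.
Proof.
move=> DQ DQ' Qx Q'x; apply: contrapT => /(disjD DQ DQ') Q0.
by have : set0 x by rewrite -Q0.
Qed.

Lemma filtration_setT n : F n setT.
Proof. by have [? /(_ set0) h _] := sF n; rewrite -(setD0 setT); exact: h. Qed.

Lemma filtration_mono m n : (m <= n)%N -> F m `<=` F n.
Proof.
move=> /subnK <-; elim: (n - m)%N => // k ih; apply: subset_trans ih _.
exact: FS.
Qed.

Lemma cube_exists n x : exists2 Q, D n Q & Q x.
Proof.
have [C [CD TC]] := atomD (filtration_setT n).
have : [set: T] x by []; rewrite TC => -[Q CQ Qx].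
by exists Q => //; exact: CD.
Qed.

(** The default [set0] is never taken, since the cubes of each generation cover the space. *)
Definition cube n x : set T := xget set0 [set Q | D n Q /\ Q x].

Lemma cubeP n x : D n (cube n x) /\ cube n x x.
Proof.
rewrite /cube; case: xgetP => [Q _ //|/= h]; have [Q DQ Qx] := cube_exists n x.
by case: (h Q).
Qed.

Lemma cubeE n Q x : D n Q -> Q x -> cube n x = Q.
Proof. by move=> DQ Qx; have [DC Cx] := cubeP n x; exact: cube_eq DC DQ Cx Qx. Qed.

(** [B] is a union of cubes of generation [n], and [Q] is either one of them or disjoint from them
    all. *)
Lemma cube_split m n Q B : (m <= n)%N -> F m B -> D n Q ->
  Q `<=` B \/ B `&` Q = set0.
Proof.
move=> mn /(filtration_mono mn) FB DQ; have [C [CD BE]] := atomD FB.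
have [CQ|nCQ] := pselect (C Q); [left|right].
  by rewrite BE => x Qx; exists Q.
apply/seteqP; split => // x [+ Qx]; rewrite BE => -[Q' CQ' Q'x].
by apply: nCQ; rewrite (cube_eq DQ (CD _ CQ') Qx Q'x).
Qed.

Lemma children_cube n Q x : D n Q -> Q x -> children D n Q (cube n.+1 x).
Proof.
move=> DQ Qx; have [DC Cx] := cubeP n.+1 x; split => //.
have [//|Q0] := cube_split (leqnSn n) (DF DQ) DC.
by have : set0 x by rewrite -Q0.
Qed.

Lemma cube_sub m n x : (m <= n)%N -> cube n x `<=` cube m x.
Proof.
move=> /subnK <-; elim: (n - m)%N => // k ih; apply: subset_trans _ ih.
by have [DC Cx] := cubeP (k + m) x; case: (children_cube DC Cx).
Qed.

Lemma cube_congr m n x y : (m <= n)%N -> cube n x y -> cube m y = cube m x.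
Proof. by move=> mn /(cube_sub mn) Cy; apply: cubeE => //; case: (cubeP m x). Qed.

Lemma bigcup_children n Q : D n Q -> \bigcup_(S in children D n Q) S = Q.
Proof.
move=> DQ; apply/seteqP; split => [x [S [_ SQ] /SQ//]|x Qx].
by exists (cube n.+1 x); [exact: children_cube|case: (cubeP n.+1 x)].
Qed.

Lemma cube0 x : cube 0 x = setT.
Proof.
have [/DF + Cx] := cubeP 0 x; rewrite F0E => -[C0|//].
by move: Cx; rewrite C0.
Qed.

(** Since the [F n] increase, their union is an algebra, and it generates the measurable sets. *)
Lemma Rintegral_le_filtration (phi : T -> R) (K : R) :
  P.-integrable setT (EFin \o phi) ->
  (forall n B, F n B -> \int[P]_(x in B) phi x <= K) ->
  forall A, measurable A -> \int[P]_(x in A) phi x <= K.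
Proof.
move=> iphi FK A; rewrite genF; apply: Rintegral_le_generated => //.
- by exists 0%N => //; case: (sF 0).
- move=> B [n _ FB]; exists n => //; rewrite -setTD.
  by have [_ + _] := sF n; apply.
- move=> B C [m _ FB] [n _ FC]; exists (maxn m n) => //.
  have FB' := filtration_mono (leq_maxl m n) FB.
  have FC' := filtration_mono (leq_maxr m n) FC.
  have [F0 _ FU] := sF (maxn m n).
  by rewrite -bigcup2E; apply: FU => -[|[|k]].
- by move=> B [n _ /mF].
- by move=> B [n _ FB]; exact: FK FB.
Qed.

(** * Consequences of homogeneity *)

Hypotheses (homP : homogeneous P D alpha) (a0 : 0 < alpha).

Let p (Q : set T) : R := fine (P Q).

Let pE Q : measurable Q -> P Q = (p Q)%:E.
Proof. by move=> mQ; rewrite fineK ?fin_num_measure. Qed.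

Lemma child_ge n Q S : D n Q -> children D n Q S -> alpha * p Q <= p S.
Proof.
move=> DQ cS; have : (alpha%:E * P Q <= P S)%E := homP DQ cS.
rewrite (pE (cube_measurable DQ)) pE; last exact: cube_measurable cS.1.
by rewrite lee_fin.
Qed.

(** From mass [1] at generation [0], each generation keeps at least the fraction [alpha]. Hence no
    cube through a point is a null set. *)
Lemma cube_gt0 n x : 0 < p (cube n x).
Proof.
elim: n => [|n ih]; first by rewrite cube0 /p probability_setT.
have [DC Cx] := cubeP n x.
by apply: lt_le_trans (child_ge DC (children_cube DC Cx)); rewrite mulr_gt0.
Qed.

Lemma trivIset_cubes n (A : set (set T)) (B : set T) :
  A `<=` D n -> trivIset A (fun S => B `&` S).
Proof.
move=> AD S S' /AD DS /AD DS' [x [[_ Sx] [_ S'x]]].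
exact: cube_eq DS DS' Sx S'x.
Qed.

(** The children are disjoint, each of mass at least [alpha * p Q], so at most [alpha^-1] of them
    fit into [Q]. *)
Lemma finite_children n Q : D n Q -> 0 < p Q -> finite_set (children D n Q).
Proof.
move=> DQ Q0; apply: contrapT => infC.
pose N := (Num.truncn alpha^-1).+1.
have [B BC NB] := infinite_set_fset N infC.
have mB : {in B, forall S, measurable S}.
  by move=> S SB; apply: (@cube_measurable n.+1); case: (BC S SB).
have tB : trivIset [set` B] id.
  move=> S S' /BC[DS _] /BC[DS' _] [x [Sx S'x]].
  exact: cube_eq DS DS' Sx S'x.
have : (P (\big[setU/set0]_(S <- B) S) <= P Q)%E.
  apply: le_measure; rewrite ?inE.
  - by rewrite -bigcup_seq; apply: fin_bigcup_measurable => // S /mB.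
  - exact: cube_measurable DQ.
  - by rewrite -bigcup_seq => x [S /BC[_ SQ] /SQ].
rewrite measure_fbigsetU// big_seq (eq_bigr (fun S => (p S)%:E)); last first.
  by move=> S /mB; exact: pE.
rewrite -big_seq sumEFin (pE (cube_measurable DQ)) lee_fin => sumB.
have : \sum_(S <- B) alpha * p Q <= \sum_(S <- B) p S.
  rewrite big_seq [leRHS]big_seq; apply: ler_sum => S SB.
  exact: child_ge DQ (BC _ SB).
rewrite big_const_seq count_predT iter_addr_0 => /le_trans/(_ sumB).
rewrite -mulr_natl mulrA -ler_pdivlMr// divff ?gt_eqF// leNgt => /negP; apply.
have : alpha^-1 < (size B)%:R.
  apply: lt_le_trans (_ : N%:R <= _); last by rewrite ler_nat.
  exact: truncnS_gt.
by rewrite -(ltr_pM2r a0) mulVf ?gt_eqF.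
Qed.

Lemma Rintegral_children (phi : T -> R) n Q B :
  P.-integrable setT (EFin \o phi) -> D n Q -> 0 < p Q -> measurable B ->
  \int[P]_(x in B `&` Q) phi x =
  \sum_(S <- fset_set (children D n Q)) \int[P]_(x in B `&` S) phi x.
Proof.
move=> iphi DQ Q0 mB; have finC := finite_children DQ Q0.
have memC S : S \in fset_set (children D n Q) -> children D n Q S.
  by rewrite in_fset_set// inE.
rewrite -Rintegral_bigsetU//.
- rewrite -bigcup_seq -setI_bigcupr fset_setK// bigcup_children//.
- by move=> S /memC[DS _]; apply: measurableI => //; exact: cube_measurable DS.
- apply: (@trivIset_cubes n.+1) => S /memC[]//.
Qed.

(** * Averages over cubes and their exponential moments *)

Variable f : T -> R.
Hypothesis intf : P.-integrable setT (EFin \o f).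

Lemma mass_avg Q : 0 < p Q -> p Q * avg P f Q = \int[P]_(x in Q) f x.
Proof. by move=> Q0; rewrite /avg mulrC divfK ?gt_eqF. Qed.

(** The martingale difference of generation [n] at [x]; [Delta_cube] identifies it with [Delta] on
    the cube through [x]. *)
Definition jump n x : R := avg P f (cube n.+1 x) - avg P f (cube n x).

Lemma integrable_affine (t k : R) :
  P.-integrable setT (EFin \o (fun x => 1 + t * (f x - k))).
Proof.
have := integrableD measurableT (finite_measure_integrable_cst P 1 measurableT)
  (integrableZl measurableT t (integrableB measurableT intf
     (finite_measure_integrable_cst P k measurableT))).
by apply: eq_integrable.
Qed.

Lemma Rintegral_affine (t k : R) Q : measurable Q -> 0 < p Q ->
  \int[P]_(x in Q) (1 + t * (f x - k)) = p Q * (1 + t * (avg P f Q - k)).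
Proof.
move=> mQ Q0.
have ic (c : R) : P.-integrable Q (EFin \o cst c).
  exact: finite_measure_integrable_cst.
have ifQ : P.-integrable Q (EFin \o f) by exact: integrableS intf.
have ifk : P.-integrable Q (EFin \o (fun x => f x - k)).
  by have := integrableB mQ ifQ (ic k); apply: eq_integrable.
have itk : P.-integrable Q (EFin \o (fun x => t * (f x - k))).
  by have := integrableZl mQ t ifk; apply: eq_integrable.
rewrite [LHS](RintegralD mQ (ic 1) itk) [X in _ + X](RintegralZl t mQ ifk).
rewrite [X in t * X](RintegralB mQ ifQ (ic k)) !Rintegral_cst// -mass_avg//.
by rewrite -/(p Q); ring.
Qed.

Hypothesis a2 : alpha <= 1 / 2.

(** This is [sum_gauss_le1] for the weights [p S / p Q], at least [alpha] by homogeneity, and the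
    centred values [t * (avg P f S - avg P f Q)]. *)
Lemma children_gauss (t : R) n Q : D n Q -> 0 < p Q ->
  \sum_(S <- fset_set (children D n Q))
    p S * expR (t * (avg P f S - avg P f Q) -
                t ^+ 2 / (4 * alpha) * (avg P f S - avg P f Q) ^+ 2) <= p Q.
Proof.
move=> DQ Q0; have finC := finite_children DQ Q0.
have memC S : S \in fset_set (children D n Q) -> children D n Q S.
  by rewrite in_fset_set// inE.
have S0 S : S \in fset_set (children D n Q) -> 0 < p S.
  by move=> /memC cS; apply: lt_le_trans (child_ge DQ cS); rewrite mulr_gt0.
set s := fset_set _ in memC S0 *.
have a01 : 0 < alpha <= 1 / 2 by rewrite a0.
have sump : \sum_(S <- s) p S / p Q = 1.
  have := Rintegral_children (finite_measure_integrable_cst P 1 measurableT)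
    DQ Q0 measurableT.
  have mQ := cube_measurable DQ.
  rewrite setTI Rintegral_cst// mul1r -/(p Q) => E.
  rewrite -mulr_suml; apply: (mulIf (lt0r_neq0 Q0)).
  rewrite divfK ?gt_eqF// mul1r [RHS]E.
  rewrite big_seq [RHS]big_seq; apply: eq_bigr => S /memC[DS _].
  by have mS := cube_measurable DS; rewrite setTI Rintegral_cst// mul1r.
have sumx : \sum_(S <- s) p S / p Q * (t * (avg P f S - avg P f Q)) = 0.
  have := Rintegral_children intf DQ Q0 measurableT.
  rewrite setTI -mass_avg// => E.
  have {}E : \sum_(S <- s) p S * avg P f S = p Q * avg P f Q.
    rewrite E big_seq [RHS]big_seq; apply: eq_bigr => S /S0 pS0.
    by rewrite setTI mass_avg.
  rewrite (eq_bigr (fun S => t / p Q * (p S * avg P f S) -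
     t * avg P f Q * (p S / p Q))); last first.
    by move=> S _; field; rewrite gt_eqF.
  rewrite big_split/= sumrN -!mulr_sumr sump E mulr1.
  by field; rewrite gt_eqF.
have pa : {in s, forall S, alpha <= p S / p Q}.
  by move=> S /memC cS; rewrite ler_pdivlMr//; exact: child_ge DQ cS.
have := sum_gauss_le1 a01 pa sump sumx.
rewrite -(ler_pM2r Q0) mul1r mulr_suml; apply: le_trans.
rewrite le_eqVlt; apply/orP; left; apply/eqP; apply: eq_bigr => S _.
rewrite [RHS]mulrAC divfK ?gt_eqF//; congr (_ * expR _).
by field; rewrite gt_eqF.
Qed.

(* The budget [r] bounds the square function below [Q]; passing to a child [S]
   spends [(avg S - avg Q) ^+ 2] of it, which is what [children_gauss] pays for. *)
Lemma Rintegral_cube_le (t k : R) N B : F N B ->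
  forall m n Q r, (n + m)%N = N -> D n Q -> 0 < p Q ->
  (forall x, Q x -> \sum_(n <= j < N) jump j x ^+ 2 <= r) ->
  \int[P]_(x in B `&` Q) (1 + t * (f x - k)) <=
  p Q * expR (t * (avg P f Q - k) + t ^+ 2 / (4 * alpha) * r).
Proof.
move=> FB; have mB := mF FB; have c0 : 0 <= t ^+ 2 / (4 * alpha).
  by apply: divr_ge0; rewrite ?sqr_ge0// mulr_ge0// ltW.
elim=> [|m ih] n Q r nN DQ Q0 Hr.
  have {nN}nN : n = N by rewrite -nN addn0.
  have [Qsub|->] := cube_split (eq_leq (esym nN)) FB DQ; last first.
    by rewrite Rintegral_set0 mulr_ge0 ?expR_ge0// ltW.
  rewrite setIidr// Rintegral_affine//; last exact: cube_measurable DQ.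
  rewrite ler_pM2l// (le_trans (expR_ge1Dx _))// ler_expR lerDl mulr_ge0//.
  (* With no generation left, the hypothesis on [r] reads [0 <= r], but only at a point of [Q];
     positive mass provides one. *)
  have [Q0'|/set0P[x Qx]] := eqVneq Q set0.
    by move: Q0; rewrite Q0' /p measure0 ltxx.
  by have := Hr _ Qx; rewrite nN big_geq.
rewrite (Rintegral_children (integrable_affine t k) DQ Q0 mB).
have finC := finite_children DQ Q0.
have memC S : S \in fset_set (children D n Q) -> children D n Q S.
  by rewrite in_fset_set// inE.
have := children_gauss t DQ Q0.
set s := fset_set _ in memC *; set e := expR (_ + _).
rewrite -(ler_pM2r (expR_gt0 _ : 0 < e)); apply: le_trans.
rewrite mulr_suml big_seq [leRHS]big_seq; apply: ler_sum => S /memC cS.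
have [DS SQ] := cS.
have S0 : 0 < p S by apply: lt_le_trans (child_ge DQ cS); rewrite mulr_gt0.
(* On [S] the jump of generation [n] is constant, equal to [avg P f S - avg P f Q]. *)
have HS x : S x ->
    \sum_(n.+1 <= j < N) jump j x ^+ 2 <= r - (avg P f S - avg P f Q) ^+ 2.
  move=> Sx; have := Hr _ (SQ _ Sx); rewrite big_ltn; last first.
    by rewrite -nN addnS ltnS leq_addr.
  by rewrite {1}/jump (cubeE DS Sx) (cubeE DQ (SQ _ Sx)) lerBrDl.
have nN' : (n.+1 + m)%N = N by rewrite addSnnS.
apply: le_trans (ih _ _ _ nN' DS S0 HS) _.
rewrite -[leRHS]mulrA ler_pM2l// -expRD ler_expR.
rewrite le_eqVlt; apply/orP; left; apply/eqP; ring.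
Qed.

(** * Jumps and the square function *)

Lemma Delta_cube n x : Delta P D n (cube n x) f x = jump n x.
Proof.
have [DC Cx] := cubeP n x; have [DC' Cx'] := cubeP n.+1 x.
rewrite /Delta /jump; congr (_ - _); last first.
  by rewrite /condE indicE mem_set// mulr1.
rewrite -(@fsbig_widen _ _ _ _ [set cube n.+1 x]).
- by rewrite fsbig_set1 /condE indicE mem_set// mulr1.
- by move=> S ->; exact: children_cube.
- move=> S [[DS _] SC] /=; rewrite /condE indicE memNset ?mulr0// => Sx.
  by apply: SC; rewrite /= (cubeE DS Sx).
Qed.

Lemma sum_jump_le_sqfun N x :
  ((Num.sqrt (\sum_(0 <= j < N) jump j x ^+ 2))%:E <= sqfun P D f x)%E.
Proof.
pose u n := (\esum_(Q in D n) ((Delta P D n Q f x) ^+ 2)%:E)%E.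
have u0 n : (0 <= u n)%E by apply: esum_ge0 => Q _; rewrite lee_fin sqr_ge0.
rewrite /sqfun -[leLHS]/(sqrte (_%:E)) lee_sqrt; last first.
  by apply: nneseries_ge0 => n _ _; exact: u0.
apply: (@le_trans _ _ (\sum_(0 <= j < N) u j)%E); last first.
  by apply: nneseries_lim_ge => n _ _; exact: u0.
rewrite -sumEFin; apply: lee_sum => n _; apply: esum_ge.
exists [set cube n x].
  by split => // S ->; case: (cubeP n x).
by rewrite fsbig_set1 Delta_cube.
Qed.

(** An almost sure bound becomes a bound everywhere: the partial sum is constant on the cube of
    generation [N] through [x], whose positive mass forces a point outside the exceptional null
    set. *)
Lemma sum_jump_le_ess_sup N x : (ess_sup P (sqfun P D f) < +oo)%E ->
  \sum_(0 <= j < N) jump j x ^+ 2 <= fine (ess_sup P (sqfun P D f)) ^+ 2.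
Proof.
move=> Sfin; set M := ess_sup _ _ in Sfin *.
set s := \sum_(_ <= _ < _) _; have s0 : 0 <= s.
  by rewrite /s sumr_ge0// => j _; rewrite sqr_ge0.
have [A [mA A0 subA]] := ess_sup_ge P (sqfun P D f).
have [DC Cx] := cubeP N x.
have [y [Cy nAy]] : exists y, cube N x y /\ ~ A y.
  apply: contrapT => /forallNP h.
  have CA : cube N x `<=` A by move=> y Cy; apply: contrapT => nA; apply: (h y).
  have := cube_gt0 N x; suff -> : p (cube N x) = 0 by rewrite ltxx.
  by rewrite /p (subset_measure0 (cube_measurable DC) mA CA A0).
have leM : (sqfun P D f y <= M)%E by apply: contrapT => nle; apply: nAy; exact: subA.
have : ((Num.sqrt s)%:E <= M)%E.
  apply: le_trans leM; apply: le_trans (sum_jump_le_sqfun N y).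
  rewrite lee_fin le_eqVlt; apply/orP; left; apply/eqP; congr Num.sqrt.
  rewrite /s big_nat [RHS]big_nat; apply: eq_bigr => j /andP[_ jN].
  by rewrite /jump (cube_congr jN Cy) (cube_congr (ltnW jN) Cy).
move: Sfin; case: (M) => // m _.
rewrite lee_fin/= => sM.
by rewrite -(sqr_sqrtr s0) lerXn2r ?nnegrE ?sqrtr_ge0// (le_trans _ sM).
Qed.

End Cubes.

(** * The subgaussian tail bound *)

Theorem theorem2p3 (d : measure_display) (T : measurableType d) (R : realType)
  (P : probability T R) (F D : nat -> set (set T)) (alpha : R) (f : T -> R) :
  atomic_filtration F D ->
  homogeneous P D alpha ->
  0 < alpha <= 1 / 2 ->
  P.-integrable setT (EFin \o f) ->
  (ess_sup P (sqfun P D f) < +oo)%E ->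
  forall lam : R, 0 <= lam ->
  (P [set x | (f x - avg P f setT > lam)%R] <=
   (expR (- (alpha * lam ^+ 2) / (fine (ess_sup P (sqfun P D f))) ^+ 2))%:E)%E.
Proof.
move=> atF homP /andP[a0 a2] intf Sfin lam lam0.
have jumpM N x := sum_jump_le_ess_sup atF homP a0 N x Sfin.
set M := fine _ in jumpM *; set A := [set x | _].
have mf : measurable_fun setT f.
  by apply/measurable_EFinP; case/integrableP: intf.
have mA : measurable A.
  have := measurable_funB mf (measurable_cst (avg P f setT)).
  move=> /(_ measurableT `]lam, +oo[%classic (measurable_itv _)).
  rewrite setTI; congr measurable; apply/seteqP; split => x /=;
    by rewrite in_itv/= andbT.
(* For [M = 0] the exponent is a division by zero and the bound reads [1]. *)
have [->|M0] := eqVneq M 0.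
  by rewrite expr0n/= invr0 mulr0 expR0 probability_le1.
have M20 : 0 < M ^+ 2 by rewrite exprn_even_gt0.
pose t := 2 * alpha * lam / M ^+ 2.
have t0 : 0 <= t by apply: divr_ge0; [rewrite !mulr_ge0// ltW|exact: ltW].
pose k := avg P f setT + lam.
pose phi x := 1 + t * (f x - k).
have iphi : P.-integrable setT (EFin \o phi) by exact: integrable_affine.
rewrite -(fineK (fin_num_measure P _ mA)) lee_fin.
apply: (@le_trans _ _ (\int[P]_(x in A) phi x)).
  rewrite -[leLHS]mul1r -Rintegral_cst//; apply: le_Rintegral => //.
  - exact: finite_measure_integrable_cst.
  - exact: integrableS iphi.
  - by move=> x; rewrite /A /phi /k/= => lx; rewrite lerDl mulr_ge0//; lra.
apply: (Rintegral_le_filtration atF iphi) mA => N B FB.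
(* Generation [0] is reached through a point, which exists because the total mass is [1]. *)
have D0 : D 0%N setT.
  have [x _] : [set: T] !=set0.
    apply/set0P/eqP => T0; have := @probability_setT _ _ _ P.
    by rewrite T0 measure0 => /eqP; rewrite eq_sym onee_eq0.
  by have [] := cubeP atF 0 x; rewrite (cube0 atF).
have PT0 : 0 < fine (P setT) by rewrite probability_setT.
(* Starting from the whole space with budget [M ^+ 2], the exponent is [- t * lam + t ^+ 2 / (4 *
   alpha) * M ^+ 2], which is the claimed one at this [t]. *)
have := @Rintegral_cube_le _ _ _ P F D alpha atF homP a0 f intf a2 t k N B FB
  N 0%N setT (M ^+ 2) (add0n _) D0 PT0 (fun x _ => jumpM N x).
rewrite setIT probability_setT mul1r => /le_trans; apply.
rewrite ler_expR le_eqVlt; apply/orP; left; apply/eqP.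
by rewrite /t /k; field; rewrite M0 gt_eqF.
Qed.
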